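(* Let $n\ge3$ and let $\mathcal T$ be a set of tile designs for the $n$-trapezohedron with symmetry group the antiprismatic group $D_{nd}$ (order $4n$). Suppose there are $t_{\mathrm{id}}$ kite tile designs, $t_f$ of which are fixed under the reflection of the face. Then the number of ways of tiling the faces of the $n$-trapezohedron up to $D_{nd}$ symmetry is $$\frac14\left(t_{\mathrm{id}}^{n}+t_{\mathrm{id}}^{n-1}t_f^{2}\right)+\frac{1}{4n}\sum_{d\mid 2n}\phi(d)\,t_{\mathrm{id}}^{2n/d},$$ where $\phi$ is Euler's totient function and $d$ runs over the positive divisors of $2n$.
   Context: Tilings. Let $P$ be a polyhedron with set of faces $\mathcal F$ and let $\mathcal A$ be a group of isometries of $P$, acting on $\mathcal F$. A set of tile designs is a finite set $\mathcal T$ together with a group action of $\mathcal A$ on $\mathcal T\times\mathcal F$ lying over the action on $\mathcal F$ (so $A\cdot(T,F)=(T',A\cdot F)$ for some $T'\in\mathcal T$). A tiling is a map $\tau:\mathcal F\to\mathcal T$; $\mathcal A$ acts on tilings by moving graphs: $A\cdot\tau$ is the tiling with $((A\cdot\tau)(A\cdot F),A\cdot F)=A\cdot(\tau(F),F)$ for all $F$. The number of ways of tiling up to $\mathcal A$ is the number of $\mathcal A$-orbits on the set of tilings. The induced symmetry group $G$ of a face $F$ is the group of isometries of $F$ realized by elements of the stabilizer $\mathcal A_F$; for $g\in G$, $t_g$ is the number of $T\in\mathcal T$ with $g\cdot(T,F)=(T,F)$, where $g$ acts via the element of $\mathcal A_F$ inducing it. Since $\mathcal A$ acts transitively on faces,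 $t_g$ does not depend on the choice of $F$. In particular $t_{\mathrm{id}}=|\mathcal T|$. Polyhedron and group. The $n$-trapezohedron (dual of the $n$-antiprism) has $2n$ kite faces; it is the convex hull of the poles $(0,0,\pm z)$ and the points $(\cos(2k\pi/n),\sin(2k\pi/n),z')$ and $(\cos((2k+1)\pi/n),\sin((2k+1)\pi/n),-z')$, $0\le k<n$, where $z,z'>0$ are chosen so that the faces are $2n$ kites, for example $z=\frac{\cos(\pi/n)+1}{\sqrt{2\cos(\pi/n)-2\cos(2\pi/n)}}$ and $z'=\frac{\sqrt{1-\cos(\pi/n)}}{\sqrt{4\cos(\pi/n)+2}}$. Here $\mathcal A=D_{nd}\cong\langle R,F\mid R^{2n}=F^2=(RF)^2=\mathrm{Id}\rangle$ is the group of order $4n$ generated by the mirror reflection $F=\mathrm{diag}(1,-1,1)$ and the rotoreflection $R=\begin{pmatrix}\cos(\pi/n)&-\sin(\pi/n)&0\\\sin(\pi/n)&\cos(\pi/n)&0\\0&0&-1\end{pmatrix}$. The symmetry group it induces on a face is $\langle f\mid f^2=e\rangle$, with $f$ the reflection of the kite in its axis of symmetry through the pole. *)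

(* Defs.v *)
From HB Require Import structures.
From mathcomp Require Import all_boot all_order all_algebra.
From mathcomp Require Import all_classical all_reals all_analysis.

Set Implicit Arguments.
Unset Strict Implicit.
Unset Printing Implicit Defensive.

Import Order.TTheory GRing.Theory Num.Theory.

Local Open Scope classical_set_scope.
Local Open Scope card_scope.
Local Open Scope ring_scope.

Definition pt (R : realType) (x y w : R) : 'cV[R]_3 :=
  \col_i [:: x; y; w]`_i.

Definition dot (R : realType) (u v : 'cV[R]_3) : R := \sum_i u i 0 * v i 0.

Definition hull (R : realType) (S : set 'cV[R]_3) : set 'cV[R]_3 :=
  smallest (@convex_set R 'cV[R]_3) S.

(* The faces are the 2-dimensional ones: the intersections of [P] with a
   supporting plane that contain three affinely independent points. *)
Definition is_face (R : realType) (P F : set 'cV[R]_3) : Prop :=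
  [/\ exists c b, [/\ c != 0, P `<=` [set x | dot c x <= b] &
                      F = P `&` [set x | dot c x = b]]
    & exists p q r, [/\ F p, F q, F r &
                        \rank (row_mx (q - p) (r - p)) = 2%N]].

Definition faces (R : realType) (P : set 'cV[R]_3) : set (set 'cV[R]_3) :=
  [set F | is_face P F].

(* The non-membership conditions say that [a], [b], [c], [d] are exactly the
   vertices of the hull. For coplanar points, together with the two equalities
   of lengths, they force [a; c] and [b; d] to be the diagonals. Rhombi and
   squares are allowed: for n = 3 all the faces are rhombi. *)
Definition is_kite (R : realType) (F : set 'cV[R]_3) : Prop :=
  exists a b c d : 'cV[R]_3,
    [/\ F = hull [set a; b; c; d],
        [/\ ~ hull [set b; c; d] a, ~ hull [set a; c; d] b,
            ~ hull [set a; b; d] c & ~ hull [set a; b; c] d],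
        dot (a - b) (a - b) = dot (a - d) (a - d)
      & dot (c - b) (c - b) = dot (c - d) (c - d)].

Definition is_pole (R : realType) (z : R) (p : 'cV[R]_3) : Prop :=
  p = pt 0 0 z \/ p = pt 0 0 (- z).

Definition upper_ring (R : realType) (n : nat) (z' : R) : set 'cV[R]_3 :=
  [set pt (cos ((2 * k)%:R * pi / n%:R)) (sin ((2 * k)%:R * pi / n%:R)) z'
     | k in `I_n].

Definition lower_ring (R : realType) (n : nat) (z' : R) : set 'cV[R]_3 :=
  [set pt (cos ((2 * k).+1%:R * pi / n%:R)) (sin ((2 * k).+1%:R * pi / n%:R))
          (- z')
     | k in `I_n].

Definition trapezohedron (R : realType) (n : nat) (z z' : R) :
    set 'cV[R]_3 :=
  hull ([set p | is_pole z p] `|` upper_ring n z' `|` lower_ring n z').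

(* The condition on the heights [z] and [z']; it is satisfied exactly when
   z' * (1 + cos (pi / n)) = z * (1 - cos (pi / n)). *)
Definition faces_are_kites (R : realType) (n : nat) (z z' : R) : Prop :=
  faces (trapezohedron n z z') #= `I_(2 * n) /\
  (forall F, faces (trapezohedron n z z') F -> is_kite F).

Definition mx3 (R : realType) (rows : seq (seq R)) : 'M[R]_3 :=
  \matrix_(i, j) (nth [::] rows i)`_j.

Definition mirror (R : realType) : 'M[R]_3 :=
  mx3 [:: [:: 1; 0; 0]; [:: 0; -1; 0]; [:: 0; 0; 1]].

Definition rotoreflection (R : realType) (n : nat) : 'M[R]_3 :=
  let t := pi / n%:R in
  mx3 [:: [:: cos t; - sin t; 0]; [:: sin t; cos t; 0]; [:: 0; 0; -1]].

Definition mx_group_closed (R : realType) (G : set 'M[R]_3) : Prop :=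
  [/\ G 1, forall g h, G g -> G h -> G (g * h) & forall g, G g -> G g^-1].

Definition Dnd (R : realType) (n : nat) : set 'M[R]_3 :=
  smallest (@mx_group_closed R) [set rotoreflection R n; mirror R].
Arguments Dnd : clear implicits.

Definition mx_image (R : realType) (g : 'M[R]_3) (F : set 'cV[R]_3) :
    set 'cV[R]_3 :=
  [set g *m x | x in F].

(* An action of the matrix group [A] on the pairs (tile design, face) lying
   over its action on the faces; the values of [rho] outside [A] are
   irrelevant. *)
Definition is_design_action (R : realType) (P : set 'cV[R]_3)
    (A : set 'M[R]_3) (T : finType)
    (rho : 'M[R]_3 -> T * faces P -> T * faces P) : Prop :=
  [/\ forall x, rho 1 x = x,
      forall g h, A g -> A h -> forall x, rho (g * h) x = rho g (rho h x)
    & forall g, A g -> forall x, val (rho g x).2 = mx_image g (val x.2)].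

Definition tiling_graph (R : realType) (P : set 'cV[R]_3) (T : finType)
    (tau : faces P -> T) : set (T * faces P) :=
  [set (tau F, F) | F in [set: faces P]].

Definition tiling_orbit (R : realType) (P : set 'cV[R]_3) (A : set 'M[R]_3)
    (T : finType) (rho : 'M[R]_3 -> T * faces P -> T * faces P)
    (tau : faces P -> T) : set (faces P -> T) :=
  [set sigma | exists2 g, A g & rho g @` tiling_graph tau = tiling_graph sigma].

Definition tiling_orbits (R : realType) (P : set 'cV[R]_3) (A : set 'M[R]_3)
    (T : finType) (rho : 'M[R]_3 -> T * faces P -> T * faces P) :
    set (set (faces P -> T)) :=
  range (tiling_orbit A rho).

Definition fixed_designs (R : realType) (P : set 'cV[R]_3) (T : finType)
    (rho : 'M[R]_3 -> T * faces P -> T * faces P) (g : 'M[R]_3)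
    (F : faces P) : nat :=
  #|[set D : T | `[< rho g (D, F) = (D, F) >]]%SET|.

(* Reflection in the line through [p] with direction [u], for points of a
   plane that contains this line. *)
Definition line_reflection (R : realType) (p u x : 'cV[R]_3) : 'cV[R]_3 :=
  p + (2 * dot (x - p) u / dot u u) *: u - (x - p).

(* [g] stabilizes the face [F] and restricts to the reflection of [F] in its
   axis of symmetry through the pole; [p + u] is another point of the axis. *)
Definition is_face_reflection (R : realType) (z : R) (F : set 'cV[R]_3)
    (g : 'M[R]_3) : Prop :=
  mx_image g F = F /\
  exists p u, [/\ is_pole z p, F p, u != 0, F (p + u)
                & forall x, F x -> g *m x = line_reflection p u x].

(* Main.v *)
Require Import Defs.
From HB Require Import structures.
From mathcomp Require Import all_boot all_order all_algebra all_fingroup.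
From mathcomp Require Import all_classical all_reals all_analysis.
From mathcomp Require Import zify ring lra.

(** Why the formula holds.  The count is an orbit count for a group of order
    4n, evaluated by the Cauchy-Frobenius lemma, so what has to be understood
    is the action of the group on the 2n faces and on the designs over them.

    Geometry enters only through the statement that the rotoreflection [r]
    permutes the faces as a single cycle of length 2n ([face_tilted] and
    [tilted_face_orbit]).  A supporting plane of the solid has the form
    [dot c x = b] with [b] positive, so a face determines [c] up to a positive
    factor, and a power of [r] which preserves the face must fix [c].  If [c]
    is not vertical, the only such power is 1, and the orbit of the face
    has 2n elements; since there are only 2n faces, it is everything.  A
    horizontal face cannot occur: if the rings are lower than the poles, a
    horizontal supporting plane meets the solid in a pole only; if they are
    not, the triangle on three consecutive ring vertices is a face whose free
    orbit exhausts the 2n faces, and none of them is horizontal.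

    The elements of the group are the [r ^+ k] and the [r ^+ k * mirror].  The
    given reflection [f] of the face [F] is not 1, hence is of the second
    kind, because no nontrivial [r ^+ k] preserves [F].  So the group consists
    of the [r ^+ k * f ^+ b], with [f] an involution and [r * f * r = f].

    Transporting the designs over [F] by the powers of [r] identifies the set
    of pairs (design, face) with T x Z/2n.  A tiling becomes a word of length
    2n over T, [r] becomes the cyclic shift, and [f] becomes the reversal
    [j |-> -j] followed by the involution [flip] by which [f] acts on the
    designs over [F] ([rho_frame], [tiling_orbitE]).  There is no further
    monodromy, since [r ^+ (2 * n) = 1].

    It remains to count fixed words ([card_word_orbits]).  The shift by [k]
    fixes [t_id ^ gcd (k, 2n)] words, and the sum over [k], grouped by the
    order of [k], is the sum over the divisors of 2n.  The element
    [r ^+ k * f] reverses the cycle by [j |-> k - j]; a fixed word is free on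
    one position of each 2-cycle and takes a value fixed by [flip] at each
    fixed position.  There are two fixed positions if [k] is even and none if
    [k] is odd, which gives n times [t_id ^ (n-1) * t_f ^ 2] plus n times
    [t_id ^ n]. *)

Set Implicit Arguments.
Unset Strict Implicit.
Unset Printing Implicit Defensive.

Import Order.TTheory GRing.Theory Num.Theory.

Local Open Scope ring_scope.

(** * Colourings of a cycle up to a twisted dihedral action *)

(** The pair [(k, b)] stands for the affine map [j |-> k + (-1)^b j] of Z/(p+2).
    An abstract group is used rather than a group of permutations or matrices
    so that the bit [b], which decides whether designs are flipped, can be
    read off an element. *)
Definition dihedral (p : nat) : Type := ('I_p.+2 * bool)%type.
HB.instance Definition _ p := Finite.on (dihedral p).

Definition dih_affine p (g : dihedral p) (j : 'I_p.+2) : 'I_p.+2 :=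
  g.1 + (-1) ^+ g.2 * j.

Definition dih_mul p (g h : dihedral p) : dihedral p :=
  (dih_affine g h.1, g.2 (+) h.2).
Definition dih_one p : dihedral p := (0, false).
Definition dih_inv p (g : dihedral p) : dihedral p :=
  (- ((-1) ^+ g.2 * g.1), g.2).

Lemma dih_affineM p (g h : dihedral p) j :
  dih_affine (dih_mul g h) j = dih_affine g (dih_affine h j).
Proof. by rewrite /dih_affine /= signr_addb mulrDr mulrA addrA. Qed.

Lemma dih_mulA p : associative (@dih_mul p).
Proof.
by move=> g h l; rewrite {1 3}/dih_mul /= dih_affineM addbA.
Qed.

Lemma dih_mul1 p : left_id (dih_one p) (@dih_mul p).
Proof. by case=> k s; rewrite /dih_mul /dih_affine /= mul1r add0r. Qed.

Lemma dih_mulV p : left_inverse (dih_one p) (@dih_inv p) (@dih_mul p).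
Proof. by case=> k s; rewrite /dih_mul /dih_affine /= addNr addbb. Qed.

HB.instance Definition _ p :=
  Finite_isGroup.Build (dihedral p) (@dih_mulA p) (@dih_mul1 p) (@dih_mulV p).

Lemma card_dihedral p : #|[set: dihedral p]| = (2 * p.+2)%N.
Proof. by rewrite cardsT card_prod card_ord card_bool mulnC. Qed.

(** A word invariant under the shift by [k] is, by Bezout, invariant under the
    shift by [g = gcd (k, p+2)], hence is the periodic repetition of an
    arbitrary word of length [g]. *)
Lemma card_fix_rotation p (T : finType) (k : 'I_p.+2) :
  #|[set w : {ffun 'I_p.+2 -> T} | [forall j, w (k + j) == w j]]|
  = (#|T| ^ gcdn k p.+2)%N.
Proof.
set m := p.+2; set g := gcdn k m.
have g_gt0 : (0 < g)%N by rewrite gcdn_gt0 orbT.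
have gm : (g %| m)%N by apply: dvdn_gcdr.
have gk : (g %| k)%N by apply: dvdn_gcdl.
have le_gm : (g <= m)%N by apply: dvdn_leq.
pose repeat (u : {ffun 'I_g -> T}) : {ffun 'I_m -> T} :=
  [ffun j : 'I_m => u (Ordinal (ltn_pmod j g_gt0))].
have repeat_inj : injective repeat.
  move=> u v /ffunP uv; apply/ffunP => i.
  have := uv (widen_ord le_gm i); rewrite !ffunE.
  suff -> : Ordinal (ltn_pmod (widen_ord le_gm i) g_gt0) = i by [].
  by apply: val_inj; rewrite /= modn_small.
rewrite -[g in RHS]card_ord -card_ffun -[RHS]cardsT -(card_imset _ repeat_inj).
apply: eq_card => w; rewrite inE; apply/forallP/imsetP => [wk | [u _ -> j]].
  pose v a := w (a%:R).
  have v_mod a q : v (a + q * m)%N = v a.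
    by congr (w _); apply: val_inj; rewrite !Zp_nat /= addnC modnMDl.
  have v_k a : v (a + k)%N = v a.
    by rewrite /v -(eqP (wk (a%:R))) natrD natr_Zp addrC.
  have v_kM c a : v (a + c * k)%N = v a.
    by elim: c => [|c IHc]; rewrite ?addn0 // mulSn (addnC k) addnA v_k.
  have v_g a : v (a + g)%N = v a.
    have [c _] := Bezoutl k (isT : (0 < m)%N).
    rewrite gcdnC -/g => /dvdnP[q gq].
    by rewrite -(v_kM c) -addnA gq v_mod.
  have v_gM c a : v (a + c * g)%N = v a.
    by elim: c => [|c IHc]; rewrite ?addn0 // mulSn (addnC g) addnA v_g.
  exists [ffun i : 'I_g => v i] => //; apply/ffunP => j; rewrite !ffunE /=.
  by rewrite -(v_gM (j %/ g)%N) addnC -divn_eq /v natr_Zp.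
apply/eqP; rewrite !ffunE; congr (u _); apply: val_inj => /=.
by rewrite modn_dvdm // -modnDml (eqP gk).
Qed.

(** The elements of order [d] in Z/m are the multiples of [m / d] by the units
    modulo [d]. *)
Lemma card_gcd_eq m d : (0 < m)%N -> (d %| m)%N ->
  #|[set k : 'I_m | m %/ gcdn k m == d]%N| = totient d.
Proof.
move=> m_gt0 /dvdnP[e mE]; have /andP[e_gt0 d_gt0] : (0 < e)%N && (0 < d)%N.
  by rewrite -muln_gt0 -mE.
have lt_em (i : 'I_d) : (e * i < m)%N by rewrite mE ltn_pmul2l.
pose scale i := Ordinal (lt_em i).
have scale_inj : injective scale.
  by move=> i j [/eqP]; rewrite eqn_pmul2l // => /eqP /val_inj.
have -> : totient d = #|[set i : 'I_d | coprime d i]|.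
  by rewrite totient_count_coprime big_mkord -sum1dep_card [RHS]big_mkcond.
rewrite -(card_imset _ scale_inj).
apply: eq_card => k; rewrite inE; apply/eqP/imsetP => [kE | [i]].
  have gE : gcdn k m = e.
    apply/eqP; rewrite -(eqn_pmul2l d_gt0) [(d * e)%N]mulnC -mE -kE.
    by rewrite divnK ?dvdn_gcdr.
  have ek : (e %| k)%N by rewrite -gE dvdn_gcdl.
  have lt_kd : (k %/ e < d)%N by rewrite ltn_divLR // mulnC -mE.
  exists (Ordinal lt_kd); last by apply: val_inj; rewrite /= mulnC divnK.
  rewrite inE /= /coprime gcdnC -(eqn_pmul2l e_gt0) muln1 muln_gcdr -mE.
  by rewrite mulnC divnK // gE.
rewrite inE /coprime gcdnC => /eqP di ->; rewrite /= mE -muln_gcdr di muln1.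
by rewrite mulKn.
Qed.

Lemma sum_expn_gcd m t : (0 < m)%N ->
  (\sum_(k < m) t ^ gcdn k m
   = \sum_(d <- divisors m) totient d * t ^ (m %/ d))%N.
Proof.
move=> m_gt0.
transitivity (\sum_(k < m) \sum_(d <- divisors m | d == m %/ gcdn k m)
                t ^ (m %/ d))%N.
  apply: eq_bigr => k _.
  have gm : (gcdn k m %| m)%N by apply: dvdn_gcdr.
  have gK : (m %/ (m %/ gcdn k m) = gcdn k m)%N by rewrite divnA // mulKn.
  rewrite -big_filter filter_pred1_uniq ?divisors_uniq ?big_seq1 ?gK //.
  by rewrite -dvdn_divisors // dvdn_div.
rewrite (exchange_big_dep predT) //= !big_seq; apply: eq_bigr => d.
rewrite -dvdn_divisors // => dm; rewrite sum_nat_const -(card_gcd_eq m_gt0 dm).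
by congr (_ * _)%N; apply: eq_card => k; rewrite !inE eq_sym.
Qed.

(** The positions [j <= r j] form a transversal of the orbits of the involution
    [r]: a fixed word is determined by its restriction to them, which is
    arbitrary except that its values at the fixed points of [r] are fixed
    by [s]. *)
Lemma card_fix_reflection m (T : finType) (s : T -> T) (r : 'I_m -> 'I_m) :
  T -> involutive s -> involutive r ->
  #|[set w : {ffun 'I_m -> T} | [forall j, s (w (r j)) == w j]]|
  = (#|[set x | s x == x]| ^ #|[set j | r j == j]|
     * #|T| ^ #|[set j : 'I_m | j < r j]|)%N.
Proof.
move=> t0 sK rK.
(* [t0] is a dummy value at the positions off the transversal, so that the
   restrictions form a product of finite sets. *)
pose F j : pred T := if r j == j then [pred x | s x == x]
                     else if (j < r j)%N then predT else pred1 t0.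
pose extend (u : {ffun 'I_m -> T}) : {ffun 'I_m -> T} :=
  [ffun j : 'I_m => if (j <= r j)%N then u j else s (u (r j))].
have extend_inj : {in family F &, injective extend}.
  move=> u v /familyP uF /familyP vF /ffunP uv; apply/ffunP => j.
  have := uv j; rewrite !ffunE; have := uF j; have := vF j.
  rewrite /F; case: (eqVneq (r j) j) => [-> | _]; rewrite ?leqnn //.
  by case: ltngtP => // _; rewrite !inE => /eqP-> /eqP->.
have -> : [set w : {ffun 'I_m -> T} | [forall j, s (w (r j)) == w j]]
          = [set extend u | u in family F].
  apply/setP => w; rewrite inE; apply/forallP/imsetP => [ws | [u uF -> j]].
    exists [ffun j : 'I_m => if (j <= r j)%N then w j else t0].
      apply/familyP => j; rewrite ffunE /F.
      case: eqP => [rj | rj]; first by rewrite rj leqnn inE -{1}rj ws.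
      by case: ltngtP => // [_|]; [rewrite inE | move/val_inj/esym].
    apply/ffunP => j; rewrite !ffunE rK; case: leqP => // /ltnW ->.
    by rewrite (eqP (ws j)).
  move/familyP: uF => /(_ j); rewrite !ffunE rK /F.
  case: (eqVneq (r j) j) => [-> | rj]; first by rewrite leqnn.
  case: ltngtP => [_ _| _ _|/val_inj/esym /eqP]; rewrite ?sK //.
  by rewrite (negPf rj).
rewrite (card_in_imset extend_inj) card_family foldrE big_map big_enum /=.
rewrite -!prod_nat_const [X in (X * _)%N]big_mkcond [X in (_ * X)%N]big_mkcond.
rewrite -big_split; apply: eq_bigr => j _ /=; rewrite /F !inE.
case: (eqVneq (r j) j) => [-> | _].
  by rewrite ltnn muln1 cardsE.
by case: ifP => _; rewrite ?card1 ?muln1 ?mul1n // cardsE.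
Qed.

Lemma card_ord_reflection m (r : 'I_m -> 'I_m) : involutive r ->
  (#|[set j | r j == j]| + 2 * #|[set j : 'I_m | j < r j]| = m)%N.
Proof.
move=> rK.
have -> : (2 * #|[set j : 'I_m | j < r j]|
          = #|[set j : 'I_m | j < r j]| + #|[set j : 'I_m | r j < j]|)%N.
  rewrite mul2n -addnn; congr (_ + _)%N.
  rewrite -(card_imset _ (can_inj rK)); apply: eq_card => j; rewrite inE.
  apply/imsetP/idP => [[i] | ltj]; first by rewrite inE => lti ->; rewrite rK.
  by exists (r j); rewrite ?inE rK.
rewrite -[RHS]card_ord -!sum1dep_card -sum1_card.
rewrite 3!(big_mkcond (fun _ => _ _)) -!big_split; apply: eq_bigr => j _ /=.
by rewrite -val_eqE /=; case: ltngtP.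
Qed.

Lemma card_fix_subr p n (k : 'I_p.+2) : p.+2 = (2 * n)%N ->
  #|[set j | k - j == j]| = (if odd k then 0 else 2)%N.
Proof.
move=> mE.
have E j : (k - j == j) = ((j + j) %% p.+2 == k)%N.
  by rewrite subr_eq eq_sym -val_eqE.
have dblE (j : 'I_p.+2) :
    ((j + j) %% p.+2 = if (j < n)%N then j + j else j + j - p.+2)%N.
  have := ltn_ord j; move=> ltj.
  case: ifP => jn; first by rewrite modn_small //; lia.
  by rewrite -[in LHS](@subnK p.+2 (j + j)) ?modnDr ?modn_small //; lia.
have ltk := ltn_ord k; have kE := odd_double_half k.
case: ifP => ok.
  apply: eq_card0 => j; rewrite inE E dblE; apply/negbTE/eqP.
  rewrite ok /= in kE; have := ltn_ord j. case: ifP => jn ltj; lia.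
rewrite ok add0n -muln2 in kE.
have h1 : (k./2 < p.+2)%N by lia.
have h2 : (k./2 + n < p.+2)%N by lia.
transitivity #|[set Ordinal h1; Ordinal h2]|.
  apply: eq_card => j; rewrite !inE E dblE -!val_eqE /=.
  by have := ltn_ord j; case: ifP => jn ltj; apply/eqP/orP => [H | []/eqP H];
    first (by (left; apply/eqP; lia) || (right; apply/eqP; lia)); lia.
rewrite cards2 -val_eqE /=; suff -> : (k./2 != k./2 + n)%N by [].
by apply/eqP; lia.
Qed.

Lemma sum_if_odd n a b :
  (\sum_(k < 2 * n) (if odd k then a else b) = n * (a + b))%N.
Proof.
rewrite -(big_mkord predT (fun k => if odd k then a else b)).
elim: n => [|n IHn]; first by rewrite muln0 big_geq.
by rewrite mulnS !big_nat_recr //= IHn oddM /=; lia.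
Qed.

Section Words.
Variables (p : nat) (T : finType) (s : T -> T) (sK : involutive s).

(** Precomposition with an affine map is a right action; the value is changed
    by [s] when the map reverses the cycle. *)
Definition turn (w : {ffun 'I_p.+2 -> T}) (g : dihedral p) :
    {ffun 'I_p.+2 -> T} :=
  [ffun j => iter g.2 s (w (dih_affine g j))].

Lemma turn1 w : turn w 1%g = w.
Proof. by apply/ffunP => j; rewrite ffunE /dih_affine /= mul1r add0r. Qed.

Lemma turnM w g h : turn w (g * h)%g = turn (turn w g) h.
Proof.
apply/ffunP => j; rewrite !ffunE -[(g * h)%g]/(dih_mul g h) dih_affineM /=.
by case: g.2; case: h.2 => //=; rewrite sK.
Qed.

Canonical turn_action := TotalAction turn1 turnM.

Lemma card_word_orbits n : T -> p.+2 = (2 * n)%N ->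
  (#|orbit turn_action [set: dihedral p] @: [set: {ffun 'I_p.+2 -> T}]|
     * (4 * n)
   = n * (#|T| ^ n + #|[set x | s x == x]| ^ 2 * #|T| ^ (n - 1))
     + \sum_(d <- divisors (2 * n)) totient d * #|T| ^ (2 * n %/ d))%N.
Proof.
move=> t0 mE.
have -> : (4 * n = #|[set: dihedral p]|)%N by rewrite card_dihedral; lia.
rewrite -Frobenius_Cauchy; last by apply/actsP=> ? _ ?; rewrite !inE.
transitivity (\sum_(k < p.+2) \sum_(b : bool)
    #|'Fix_([set: {ffun 'I_p.+2 -> T}] | turn_action)[(k, b)
       : dihedral p]%g|)%N.
  by rewrite pair_bigA; apply: eq_big => [g | [k b] _] //; rewrite inE.
rewrite (eq_bigr _ (fun k _ => big_bool _ _)) /=.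
rewrite big_split /=; congr (_ + _)%N; last first.
  rewrite -mE -sum_expn_gcd //; apply: eq_bigr => k _.
  rewrite -card_fix_rotation; apply: eq_card => w.
  rewrite !inE finset.sub1set !inE.
  apply/eqP/forallP => [wk j | wk].
    by rewrite -{2}wk ffunE /dih_affine /= mul1r.
  by apply/ffunP => j; rewrite ffunE /dih_affine /= mul1r; apply/eqP.
rewrite -(sum_if_odd n) -mE; apply: eq_bigr => k _.
pose r j : 'I_p.+2 := k - j.
have rK : involutive r by move=> j; rewrite /r opprB addrC subrK.
have rfix : #|[set j | r j == j]| = (if odd k then 0 else 2)%N.
  exact: card_fix_subr mE.
have -> : #|'Fix_([set: _] | turn_action)[(k, true)]%g|
  = #|[set w : {ffun 'I_p.+2 -> T} | [forall j, s (w (r j)) == w j]]|.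
  apply: eq_card => w; rewrite !inE finset.sub1set !inE.
  apply/eqP/forallP => [wk j | wk].
    by rewrite -{2}wk ffunE /dih_affine /= mulN1r.
  by apply/ffunP => j; rewrite ffunE /dih_affine /= mulN1r; exact/eqP/wk.
rewrite card_fix_reflection //.
have := card_ord_reflection rK; rewrite rfix.
case: ifP => _ cE; rewrite ?expn0 ?mul1n; first by congr (_ ^ _)%N; lia.
by congr (_ * _ ^ _)%N; lia.
Qed.

End Words.

Local Open Scope classical_set_scope.
Local Open Scope card_scope.
Local Open Scope ring_scope.

(** * Points, planes and matrices of 3-space *)

Lemma pt_coords (R : realType) (x : 'cV[R]_3) :
  x = pt (x 0 0) (x 1 0) (x 2%:R 0).
Proof.
apply/colP => -[[|[|[|]]] ? //]; rewrite mxE /=;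
  by congr (x _ _); apply: val_inj.
Qed.

Lemma pt_inj (R : realType) (x y w x' y' w' : R) :
  pt x y w = pt x' y' w' -> [/\ x = x', y = y' & w = w'].
Proof.
by move=> /colP E; split; [have := E 0 | have := E 1 | have := E 2%:R];
  rewrite !mxE.
Qed.

Lemma dot_pt (R : realType) (a b c x y w : R) :
  dot (pt a b c) (pt x y w) = a * x + b * y + c * w.
Proof. by rewrite /dot !big_ord_recl big_ord0 !mxE /= addr0 addrA. Qed.

Lemma dot_ptr (R : realType) (c : 'cV[R]_3) (x y w : R) :
  dot c (pt x y w) = c 0 0 * x + c 1 0 * y + c 2%:R 0 * w.
Proof. by rewrite {1}[c]pt_coords dot_pt. Qed.

Lemma dotDr (R : realType) (c x y : 'cV[R]_3) :
  dot c (x + y) = dot c x + dot c y.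
Proof.
by rewrite /dot -big_split; apply: eq_bigr => i _; rewrite mxE mulrDr.
Qed.

Lemma dotZr (R : realType) (c x : 'cV[R]_3) a : dot c (a *: x) = a * dot c x.
Proof.
by rewrite /dot mulr_sumr; apply: eq_bigr => i _; rewrite mxE mulrCA.
Qed.

Lemma dotZl (R : realType) (c x : 'cV[R]_3) a : dot (a *: c) x = a * dot c x.
Proof.
by rewrite /dot mulr_sumr; apply: eq_bigr => i _; rewrite mxE mulrA.
Qed.

Lemma dotBr (R : realType) (c x y : 'cV[R]_3) :
  dot c (x - y) = dot c x - dot c y.
Proof. by rewrite -scaleN1r dotDr dotZr mulN1r. Qed.

Lemma mulmx_trmx_dot (R : realType) (c x : 'cV[R]_3) : c^T *m x = (dot c x)%:M.
Proof.
apply/matrixP => i j; rewrite !ord1 !mxE mulr1n.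
by apply: eq_bigr => k _; rewrite mxE.
Qed.

(** The normals of a plane form a line: the left kernel of a 3 x 2 matrix of
    rank 2 has rank 1. *)
Lemma plane_normal_unique (R : realType) (u v c c' : 'cV[R]_3) :
  \rank (row_mx u v) = 2%N -> c != 0 ->
  dot c u = 0 -> dot c v = 0 -> dot c' u = 0 -> dot c' v = 0 ->
  exists a, c' = a *: c.
Proof.
move=> rk c0 cu cv c'u c'v.
have ker d : dot d u = 0 -> dot d v = 0 -> (d^T <= kermx (row_mx u v))%MS.
  move=> du dv; apply/sub_kermxP; rewrite mul_mx_row !mulmx_trmx_dot du dv.
  by rewrite raddf0 row_mx0.
have cK := ker _ cu cv.
have : (kermx (row_mx u v) <= c^T)%MS.
  rewrite -(geq_leqif (mxrank_leqif_sup cK)) mxrank_ker rk.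
  by rewrite lt0n mxrank_eq0 trmx_eq0.
move/(submx_trans (ker _ c'u c'v))/sub_rVP => [a aE]; exists a.
by rewrite -[c']trmxK aE linearZ /= trmxK.
Qed.

Lemma rank_row_mx_scale (R : realType) (u : 'cV[R]_3) a b :
  (\rank (row_mx (a *: u) (b *: u)) <= 1)%N.
Proof.
rewrite -!mul_mx_scalar -mul_mx_row (leq_trans (mxrankM_maxl _ _)) //.
exact: rank_leq_col.
Qed.

Lemma mulmx_pt_inj (R : realType) (A B : 'M[R]_3) :
  (forall x y w, A *m pt x y w = B *m pt x y w) -> A = B.
Proof.
move=> AB; apply/matrixP => i j.
have : col j A = col j B.
  by rewrite !colE [delta_mx _ _]pt_coords AB.
by move/colP/(_ i); rewrite !mxE.
Qed.

Lemma mx3_pt (R : realType) (a b c a' b' c' a'' b'' c'' x y w : R) :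
  mx3 [:: [:: a; b; c]; [:: a'; b'; c']; [:: a''; b''; c'']] *m pt x y w
  = pt (a * x + b * y + c * w) (a' * x + b' * y + c' * w)
       (a'' * x + b'' * y + c'' * w).
Proof.
by apply/colP => -[[|[|[|]]] ? //];
  rewrite mxE !big_ord_recl big_ord0 !mxE /= addr0 addrA.
Qed.

Lemma mirror_pt (R : realType) (x y w : R) :
  mirror R *m pt x y w = pt x (- y) w.
Proof. by rewrite mx3_pt; congr pt; ring. Qed.

Lemma hull_halfspace (R : realType) (S : set 'cV[R]_3) c b :
  S `<=` [set x | dot c x <= b] -> hull S `<=` [set x | dot c x <= b].
Proof.
apply: smallest_sub => x y l; rewrite !inE /= => cx cy.
rewrite [dot _ _](_ : _ = l%:num * dot c x + (1 - l%:num) * dot c y).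
  have l0 : 0 <= l%:num by []. have l1 : 0 <= 1 - l%:num by rewrite subr_ge0.
  by nra.
by rewrite -!dotZr -dotDr.
Qed.

Lemma mx_image1 (R : realType) (F : set 'cV[R]_3) : mx_image 1 F = F.
Proof.
by apply/seteqP; split=> [_ [x Fx <-]|x Fx]; [|exists x]; rewrite ?mul1mx.
Qed.

Lemma mx_imageM (R : realType) (g h : 'M[R]_3) (F : set 'cV[R]_3) :
  mx_image (g * h) F = mx_image g (mx_image h F).
Proof.
apply/seteqP; split=> [_ [x Fx <-]|_ [_ [x Fx <-] <-]].
  by exists (h *m x); [exists x | rewrite mulmxA].
by exists x; rewrite // -mulmxA.
Qed.

(** * The group of the trapezohedron *)

Definition angle (R : realType) (n k : nat) : R := k%:R * (pi / n%:R).
Arguments angle : clear implicits.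

Lemma angleD (R : realType) n j k :
  angle R n (j + k) = angle R n j + angle R n k.
Proof. by rewrite /angle natrD mulrDl. Qed.

Lemma rotoX_pt (R : realType) n k (x y w : R) :
  rotoreflection R n ^+ k *m pt x y w
  = pt (cos (angle R n k) * x - sin (angle R n k) * y)
       (sin (angle R n k) * x + cos (angle R n k) * y)
       ((-1) ^+ k * w).
Proof.
elim: k => [|k IHk].
  by rewrite mul1mx /angle mul0r sin0 cos0 expr0; congr pt; ring.
have aS : angle R n k.+1 = angle R n k + pi / n%:R.
  by rewrite -(addn1 k) angleD /angle mul1r.
rewrite [in LHS]exprS -mulmxA IHk mx3_pt aS cosD sinD exprS.
by congr pt; ring.
Qed.

Lemma angle_n (R : realType) n : (0 < n)%N -> angle R n n = pi.
Proof. by move=> n0; rewrite /angle mulrC divfK // pnatr_eq0 -lt0n. Qed.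

Lemma rotoX_period (R : realType) n : (0 < n)%N ->
  rotoreflection R n ^+ (2 * n) = 1.
Proof.
move=> n0; apply: mulmx_pt_inj => x y w; rewrite rotoX_pt mul1mx.
rewrite mul2n -addnn angleD angle_n // -mulr2n cos2pi sin2pi addnn -muln2.
by rewrite exprM sqrr_sign; congr pt; ring.
Qed.

Lemma mirror_sqr (R : realType) : mirror R * mirror R = 1.
Proof.
apply: mulmx_pt_inj => x y w; rewrite -mulmxA !mirror_pt mul1mx.
by congr pt; ring.
Qed.

Lemma roto_mirror (R : realType) n :
  rotoreflection R n * mirror R * rotoreflection R n = mirror R.
Proof.
apply: mulmx_pt_inj => x y w; rewrite -!mulmxA -[rotoreflection R n]expr1.
have := cos2sin2 (angle R n 1).
rewrite rotoX_pt !mirror_pt rotoX_pt.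
set co := cos _; set si := sin _ => E.
by congr pt; ring: E.
Qed.

(** If conjugation by [f] inverts [r], it inverts the powers of [r]; the
    equation [r * f * r = f] says so without inverses. *)
Lemma reversed_expr (A : pzRingType) (r f : A) k : r * f * r = f ->
  r ^+ k * f * r ^+ k = f.
Proof.
move=> rfr; elim: k => [|k IHk]; first by rewrite mul1r mulr1.
rewrite [in X in X * _]exprSr exprS -!mulrA (mulrA r) (mulrA (r * f)) rfr.
by rewrite mulrA.
Qed.

Lemma roto_expr_mirror (R : realType) n k :
  rotoreflection R n ^+ k * mirror R * rotoreflection R n ^+ k = mirror R.
Proof. exact/reversed_expr/roto_mirror. Qed.

Lemma Dnd_closed (R : realType) n : mx_group_closed (Dnd R n).
Proof.
split=> [|g h Dg Dh|g Dg] A cA; have [[A1 AM AV] _] := cA => //.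
  by apply: AM; [apply: Dg | apply: Dh].
by apply: AV; apply: Dg.
Qed.

Lemma closedX (R : realType) (A : set 'M[R]_3) g k :
  mx_group_closed A -> A g -> A (g ^+ k).
Proof.
case=> A1 AM _ Ag; elim: k => [|k IHk]; rewrite ?expr0 // exprS.
exact: AM.
Qed.

Lemma Dnd_roto (R : realType) n : Dnd R n (rotoreflection R n).
Proof. by apply: sub_gen_smallest; left. Qed.

Lemma mx_inv_eq (R : realType) (g h : 'M[R]_3) : g * h = 1 -> g^-1 = h.
Proof.
move=> gh; have hg : h * g = 1 by apply: mulmx1C.
have gU : g \is a GRing.unit by apply/unitrP; exists h.
by rewrite -[LHS]mulr1 -gh mulKr.
Qed.

(** The listed elements are closed under products because
    [mirror * r ^+ k = r ^+ (2 * n - k) * mirror]. *)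
Lemma Dnd_elements (R : realType) n g : (0 < n)%N -> Dnd R n g ->
  exists k (b : bool),
    (k < 2 * n)%N /\ g = rotoreflection R n ^+ k * mirror R ^+ b.
Proof.
move=> n0; set r := rotoreflection R n.
have rm := rotoX_period R n0; rewrite -/r in rm.
have mm k : (k %% (2 * n) < 2 * n)%N by rewrite ltn_pmod // muln_gt0.
pose D : set 'M[R]_3 := [set g | exists k (b : bool), (k < 2 * n)%N /\
  g = r ^+ k * mirror R ^+ b].
suff /[apply] : Dnd R n `<=` D by [].
apply: smallest_sub => [|g' [|] ->]; last first.
- by exists 0%N, true; rewrite muln_gt0 n0 expr0 mul1r.
- exists 1%N, false; rewrite expr0 mulr1 expr1; split=> //.
  by case: (n) n0 => // n' _; rewrite mulnS.
split=> [|g1 g2 [k1 [b1 [_ ->]]] [k2 [b2 [lt2 ->]]]|g1 [k [b [ltk ->]]]].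
- by exists 0%N, false; rewrite muln_gt0 n0 expr0 mulr1.
- case: b1; last first.
    exists ((k1 + k2) %% (2 * n))%N, b2; split=> //.
    by rewrite expr_mod // expr0 mulr1 exprD mulrA.
  exists ((k1 + (2 * n - k2)) %% (2 * n))%N, (~~ b2); split=> //.
  rewrite expr_mod // exprD expr1.
  have -> : mirror R ^+ (~~ b2) = mirror R * mirror R ^+ b2.
    by case: b2; rewrite ?expr0 ?expr1 ?mirror_sqr ?mulr1.
  rewrite -!mulrA; congr (_ * _); rewrite !mulrA; congr (_ * _).
  rewrite -[in LHS](roto_expr_mirror R n (2 * n - k2)) -/r -mulrA -exprD.
  by rewrite subnK ?rm ?mulr1 // ltnW.
- case: b; last first.
    exists ((2 * n - k) %% (2 * n))%N, false; split=> //; apply: mx_inv_eq.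
    by rewrite expr_mod // expr0 !mulr1 -exprD subnKC // ltnW.
  exists k, true; split=> //; apply: mx_inv_eq.
  by rewrite expr1 mulrA roto_expr_mirror mirror_sqr.
Qed.

(** * Multiples of the angle pi / n *)

Lemma cos_lt1 (R : realType) (x : R) : 0 < x -> x < pi *+ 2 -> cos x < 1.
Proof.
rewrite mulr2n => x0 x2; have s0 : 0 < sin (x / 2) by apply: sin_gt0_pi; lra.
have -> : x = (x / 2) *+ 2 by rewrite mulr2n; lra.
rewrite cos_mulr2n cos2sin2 mulr2n; nra.
Qed.

Lemma cos_le_of_between (R : realType) (x y : R) :
  0 <= x -> x <= y -> y <= pi *+ 2 - x -> cos y <= cos x.
Proof.
rewrite mulr2n => x0 xy yx.
pose u := (y + x) / 2; pose w := (y - x) / 2.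
have su : 0 <= sin u by apply: sin_ge0_pi; rewrite /u; lra.
have sw : 0 <= sin w by apply: sin_ge0_pi; rewrite /w; lra.
have -> : cos y = cos u * cos w - sin u * sin w.
  by rewrite -cosD; congr cos; rewrite /u /w; lra.
have -> : cos x = cos u * cos w + sin u * sin w.
  by rewrite -cosB; congr cos; rewrite /u /w; lra.
nra.
Qed.

Lemma angle_gt0 (R : realType) n k : (0 < n)%N -> (0 < k)%N -> 0 < angle R n k.
Proof.
by move=> n0 k0; rewrite /angle mulr_gt0 ?divr_gt0 ?pi_gt0 ?ltr0n.
Qed.

Lemma ltr_angle (R : realType) n j k : (0 < n)%N ->
  (angle R n j < angle R n k) = (j < k)%N.
Proof.
by move=> n0; rewrite /angle ltr_pM2r ?ltr_nat // divr_gt0 ?pi_gt0 ?ltr0n.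
Qed.

Lemma ler_angle (R : realType) n j k : (0 < n)%N ->
  (angle R n j <= angle R n k) = (j <= k)%N.
Proof.
by move=> n0; rewrite /angle ler_pM2r ?ler_nat // divr_gt0 ?pi_gt0 ?ltr0n.
Qed.

Lemma angle_2n (R : realType) n : (0 < n)%N -> angle R n (2 * n) = pi *+ 2.
Proof. by move=> n0; rewrite mul2n -addnn angleD angle_n. Qed.

Lemma cos_angle_eq1 (R : realType) n k : (0 < n)%N -> (k < 2 * n)%N ->
  cos (angle R n k) = 1 -> k = 0%N.
Proof.
move=> n0 ltk c1; case: (posnP k) => // k0.
have := @cos_lt1 R (angle R n k); rewrite c1 ltxx -(angle_2n R n0) ltr_angle //.
by rewrite angle_gt0 // ltk => /(_ isT isT).
Qed.

(** * Faces of the trapezohedron *)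

(** The two rings form one sequence, alternating between the heights [z'] and
    [- z'], along which the rotoreflection is the shift. *)
Definition ring_pt (R : realType) (n : nat) (z' : R) (k : nat) : 'cV[R]_3 :=
  pt (cos (angle R n k)) (sin (angle R n k)) ((-1) ^+ k * z').

Section Trapezohedron.
Variables (R : realType) (n : nat) (z z' : R).
Local Notation P := (trapezohedron n z z').
Local Notation v := (ring_pt n z').
Local Notation r := (rotoreflection R n).

Lemma trapezohedron_pole p : is_pole z p -> P p.
Proof. by move=> pp; apply: sub_gen_smallest; left; left. Qed.

Lemma trapezohedron_ring k : (k < 2 * n)%N -> P (v k).
Proof.
move=> ltk; apply: sub_gen_smallest; have kE := odd_double_half k.
have lth : (k./2 < n)%N by lia.
rewrite /ring_pt /angle mulrA -signr_odd; case: (odd k) kE => /= kE.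
  right; exists k./2 => //=; rewrite expr1 mulN1r.
  by rewrite mul2n (_ : (k./2).*2.+1 = k).
left; right; exists k./2 => //=; rewrite expr0 mul1r.
by rewrite mul2n (_ : (k./2).*2 = k).
Qed.

Lemma trapezohedron_halfspace a b c h :
  c * z <= h -> - (c * z) <= h ->
  (forall k, (k < 2 * n)%N -> dot (pt a b c) (v k) <= h) ->
  P `<=` [set x | dot (pt a b c) x <= h].
Proof.
move=> hz hNz hv; apply: hull_halfspace => x [[[|]|]|].
- by move=> -> /=; rewrite dot_pt; lra.
- by move=> -> /=; rewrite dot_pt; lra.
- case=> k /= ltk <-; have /hv : (2 * k < 2 * n)%N by lia.
  by rewrite /ring_pt /angle mulrA -signr_odd oddM /= expr0 mul1r.
- case=> k /= ltk <-; have /hv : ((2 * k).+1 < 2 * n)%N by lia.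
  by rewrite /ring_pt /angle mulrA -signr_odd /= oddM /= expr1 mulN1r.
Qed.

Hypotheses (n_ge3 : (3 <= n)%N) (z_gt0 : 0 < z) (z'_gt0 : 0 < z').

Local Notation a := (angle R n).

Let n_gt0 : (0 < n)%N. Proof. exact: leq_trans n_ge3. Qed.

Definition supporting (c : 'cV[R]_3) (b : R) : Prop :=
  c != 0 /\ P `<=` [set x | dot c x <= b].

Lemma supporting_pole c b : supporting c b -> `|c 2%:R 0| * z <= b.
Proof.
case=> _ cb.
have zP : dot c (pt 0 0 z) <= b by apply: cb; apply: trapezohedron_pole; left.
have zN : dot c (pt 0 0 (- z)) <= b.
  by apply: cb; apply: trapezohedron_pole; right.
move: zP zN; rewrite !dot_ptr.
by case: (lerP 0 (c 2%:R 0)) => h; rewrite ?(ger0_norm h) ?(ltr0_norm h); nra.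
Qed.

Lemma supporting_ring c b k :
  supporting c b -> (k < 2 * n)%N -> dot c (v k) <= b.
Proof. by case=> _ cb ltk; apply: cb; apply: trapezohedron_ring. Qed.

(** The origin is interior to the solid: the poles are opposite, and so are the
    horizontal parts of the ring vertices [k] and [k + n].  With [b = 0] all
    the inequalities [dot c x <= b] at the vertices would be equalities, and
    [c] would vanish. *)
Lemma supporting_gt0 c b : supporting c b -> 0 < b.
Proof.
move=> cb; have cP := supporting_pole cb.
have cR k := @supporting_ring _ _ k cb.
case: cb => c0 _; rewrite lt_neqAle andbC.
have b0 : 0 <= b by apply: le_trans cP; rewrite mulr_ge0 // ltW.
rewrite b0 /=; apply: contra_neq c0 => bE; rewrite -{b0}bE in cP cR.
have c3 : c 2%:R 0 = 0.
  by apply/eqP; rewrite -normr_le0 -(pmulr_lle0 _ z_gt0).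
have dv k : dot c (v k) = c 0 0 * cos (a k) + c 1 0 * sin (a k).
  by rewrite dot_ptr c3 mul0r addr0.
have dvn k : dot c (v (k + n)) = - dot c (v k).
  by rewrite !dv angleD angle_n // -[pi]mulr1n; rewrite cosDpi sinDpi; ring.
have v0 k : (k < n)%N -> dot c (v k) = 0.
  move=> ltk; have := cR k; have := cR (k + n)%N; rewrite dvn oppr_le0.
  by move=> h1 h2; apply: le_anti; rewrite h2 ?h1 //; lia.
have := v0 0%N n_gt0; rewrite dv /angle mul0r cos0 sin0 mulr1 mulr0 addr0 => c1.
have := v0 1%N (leq_trans _ n_ge3); rewrite dv c1 mul0r add0r => /(_ isT)/eqP.
have s1 : 0 < sin (a 1).
  apply: sin_gt0_pi; rewrite angle_gt0 // -(angle_n R n_gt0) ltr_angle //.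
  by lia.
rewrite mulf_eq0 (gt_eqF s1) orbF => /eqP c2.
by rewrite [c]pt_coords c1 c2 c3; apply/colP => -[[|[|[|]]] ? //]; rewrite !mxE.
Qed.

Definition tilted (c : 'cV[R]_3) : Prop := c 0 0 != 0 \/ c 1 0 != 0.

Lemma not_tilted c : ~ tilted c -> c = pt 0 0 (c 2%:R 0).
Proof.
move=> ct; rewrite {1}[c]pt_coords; congr pt.
  by apply/eqP; apply: contra_notT ct; left.
by apply/eqP; apply: contra_notT ct; right.
Qed.

Definition face_by (c : 'cV[R]_3) (b : R) (F : set 'cV[R]_3) : Prop :=
  supporting c b /\ F = P `&` [set x | dot c x = b].

Lemma faceP F : is_face P F -> exists c b, face_by c b F.
Proof. by case=> -[c [b [c0 cb ->]]] _; exists c, b. Qed.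

(** A face spans its plane, so an affine equation that holds on it is a multiple
    of the equation of the plane. *)
Lemma face_dot_constant F c b d e : is_face P F -> face_by c b F ->
  (forall x, F x -> dot d x = e) -> exists2 l, d = l *: c & e = l * b.
Proof.
move=> [_ [p [q [s [Fp Fq Fs rk]]]]] [[c0 _] FE] de.
have cb x : F x -> dot c x = b by rewrite FE => -[].
have [||||l dE] := plane_normal_unique (c' := d) rk c0.
- by rewrite dotBr !cb // subrr.
- by rewrite dotBr !cb // subrr.
- by rewrite dotBr !de // subrr.
- by rewrite dotBr !de // subrr.
by exists l; rewrite // -(de _ Fp) dE dotZl cb.
Qed.

(** If [r ^+ k] preserves the face, the transpose of [r ^+ k] maps [c] to a
    multiple of [c], and the factor is 1 because [b] is not 0.  Its action on
    the nonzero horizontal part of [c] is a rotation, which must be trivial. *)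
Lemma face_rotoX_free F c b k : is_face P F -> face_by c b F -> tilted c ->
  (k < 2 * n)%N -> mx_image (r ^+ k) F = F -> k = 0%N.
Proof.
move=> faceF Fcb ct ltk rF; apply: (cos_angle_eq1 (R := R) n_gt0 ltk).
set co := cos (a k); pose si := sin (a k).
(* [d] is the image of [c] under the transpose of [r ^+ k]. *)
pose d := pt (co * c 0 0 + si * c 1 0) (- si * c 0 0 + co * c 1 0)
             ((-1) ^+ k * c 2%:R 0).
have dE x : dot d x = dot c (r ^+ k *m x).
  by rewrite [x]pt_coords rotoX_pt dot_pt dot_ptr -/co -/si; ring.
have db x : F x -> dot d x = b.
  move=> Fx; have : F (r ^+ k *m x) by rewrite -rF; exists x.
  by rewrite dE; case: Fcb => _ {1}-> [].
have [l dl bl] := face_dot_constant faceF Fcb db.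
have b0 := supporting_gt0 Fcb.1.
have l1 : l = 1.
  by apply: (mulIf (lt0r_neq0 b0)); rewrite -bl mul1r.
rewrite l1 scale1r [RHS]pt_coords in dl; case/pt_inj: dl => e1 e2 _.
have : (c 0 0 ^+ 2 + c 1 0 ^+ 2) * (co - 1) = 0.
  transitivity (c 0 0 * (co * c 0 0 + si * c 1 0 - c 0 0)
                + c 1 0 * (- si * c 0 0 + co * c 1 0 - c 1 0)); first ring.
  by rewrite e1 e2 !subrr !mulr0 addr0.
move/eqP; rewrite mulf_eq0 subr_eq0 => /orP[|/eqP //].
rewrite paddr_eq0 ?sqr_ge0 // !sqrf_eq0 => /andP[/eqP c1 /eqP c2].
by case: ct => /eqP.
Qed.

(** The orbit of the face has 2n elements, and there are only 2n faces. *)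
Lemma tilted_face_orbit F c b : faces P #= `I_(2 * n) ->
  (forall k G, is_face P G -> is_face P (mx_image (r ^+ k) G)) ->
  is_face P F -> face_by c b F -> tilted c ->
  injective (fun k : 'I_(2 * n) => mx_image (r ^+ k) F) /\
  forall G, is_face P G -> exists k : 'I_(2 * n), G = mx_image (r ^+ k) F.
Proof.
move=> cardP stable faceF Fcb ct.
have inj : injective (fun k : 'I_(2 * n) => mx_image (r ^+ k) F).
  suff lt_neq (i j : 'I_(2 * n)) : mx_image (r ^+ i) F = mx_image (r ^+ j) F ->
      ~ (i < j)%N.
    move=> i j ij; case: (ltngtP i j) => [/lt_neq|/lt_neq|/val_inj //].
      by move=> /(_ ij).
    by move=> /(_ (esym ij)).
  move=> ij lt_ij; have := ltn_ord j => ltj.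
  suff : (j - i)%N = 0%N by lia.
  apply: (face_rotoX_free faceF Fcb ct); first lia.
  have -> : (r ^+ (j - i) = r ^+ (2 * n - i) * r ^+ j)%R.
    rewrite -exprD (_ : 2 * n - i + j = 2 * n + (j - i))%N; last lia.
    by rewrite exprD rotoX_period // mul1r.
  rewrite mx_imageM -ij -mx_imageM -exprD subnK ?rotoX_period ?mx_image1 //.
  exact: ltnW.
split=> // G faceG.
have /card_set_bijP[idx [idxP idx_inj _]] := cardP.
have lt_idx k : (idx (mx_image (r ^+ k) F) < 2 * n)%N.
  by apply: idxP; apply: stable.
pose h (k : 'I_(2 * n)) := Ordinal (lt_idx k).
have h_inj : injective h.
  move=> i j [] /idx_inj ij; apply: inj; apply: ij; rewrite inE; exact: stable.
have ltG : (idx G < 2 * n)%N by apply: idxP.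
have [k hk] : exists k, h k = Ordinal ltG.
  by have [h' _ h'K] := injF_bij h_inj; exists (h' (Ordinal ltG)).
exists k; apply/esym/idx_inj; rewrite ?inE //; first exact: stable.
by case: hk.
Qed.

Lemma pt00_neq0 (c : R) : pt 0 0 c != 0 -> c != 0.
Proof.
by apply: contra_neq => ->; apply/colP => -[[|[|[|]]] ? //]; rewrite !mxE.
Qed.

(** A horizontal supporting plane is at least as high as the poles.  When the
    rings are lower, the solid lies in steep cones around the poles, so that
    the plane meets it in one point only; this contradicts that a face
    spans its plane. *)
Lemma face_tilted_low_ring F c b : z' < z -> is_face P F ->
  face_by c b F -> tilted c.
Proof.
move=> zz faceF Fcb; apply: contrapT => /not_tilted cE.
have b_pole := supporting_pole Fcb.1.
have [[c0 _] FE] := Fcb.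
set c3 := c _ _ in cE b_pole.
have c3_0 : c3 != 0 by move: c0; rewrite cE; apply: pt00_neq0.
pose s : R := Num.sg c3.
have s1 : s = 1 \/ s = -1.
  by move: c3_0; rewrite /s neq_lt => /orP[/ltr0_sg|/gtr0_sg] ->; [right|left].
have cs : c3 = s * `|c3| by rewrite -numEsg.
have heightF x : F x -> s * x 2%:R 0 = b / `|c3|.
  rewrite FE => -[_ /=]; rewrite cE [x]pt_coords dot_pt !mul0r !add0r mxE /=.
  move=> <-; have n0 : `|c3| != 0 by rewrite normr_eq0.
  by apply: (mulIf n0); rewrite divfK // [in RHS]cs; ring.
(* [M] is the slope for which the half-space with normal [(e, 0, s M)] through
   the pole [(0, 0, s z)] contains the unit circle at the height of the ring. *)
pose M := (z - z')^-1.
have M0 : 0 < M by rewrite invr_gt0 subr_gt0.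
have Mz : 0 < M * z by rewrite mulr_gt0.
have ME : M * (z - z') = 1 by rewrite mulVf // subr_eq0 gt_eqF.
have bound (e : R) : e = 1 \/ e = -1 ->
    P `<=` [set x | dot (pt e 0 (s * M)) x <= M * z].
  move=> e1; apply: trapezohedron_halfspace => [||k ltk].
  - by case: s1 => ->; rewrite ?mulN1r ?mulNr ?mul1r; lra.
  - by case: s1 => ->; rewrite ?mulN1r ?mulNr ?mul1r; lra.
  rewrite dot_pt mul0r addr0.
  have h1 : e * cos (a k) <= 1.
    have := cos_le1 (a k); have := cos_geN1 (a k).
    by case: e1 => ->; rewrite ?mul1r ?mulN1r; lra.
  have h2 : s * (-1) ^+ k <= 1.
    rewrite -signr_odd; case: (odd k); case: s1 => ->;
      by rewrite ?expr0 ?expr1; lra.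
  have h3 : M * z' * (s * (-1) ^+ k) <= M * z'.
    by apply: ler_piMr => //; rewrite mulr_ge0 // ltW.
  have -> : s * M * ((-1) ^+ k * z') = M * z' * (s * (-1) ^+ k) by ring.
  by move: ME; rewrite mulrBr; lra.
have axisF x : F x -> x 0 0 = 0.
  move=> Fx; have Px : P x by move: Fx; rewrite FE => -[].
  have zx : z <= s * x 2%:R 0.
    by rewrite heightF // ler_pdivlMr ?normr_gt0 // mulrC.
  have Mzx : M * z <= M * (s * x 2%:R 0) by rewrite ler_pM2l.
  have B e : e = 1 \/ e = -1 -> e * x 0 0 <= 0.
    by move=> /bound/(_ _ Px) /=; rewrite [x]pt_coords dot_pt !mxE /=; lra.
  by have := B 1 (or_introl erefl); have := B (-1) (or_intror erefl); lra.
have [|l1 e1 _] := face_dot_constant (d := pt 1 0 0) (e := 0) faceF Fcb.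
  by move=> x /axisF x1; rewrite [x]pt_coords dot_pt x1; ring.
move: e1; rewrite cE => /colP/(_ 0); rewrite !mxE /= mulr0 => /eqP.
by rewrite oner_eq0.
Qed.

(** The normal of the plane through the ring vertices 0, 1 and 2. *)
Definition lateral_normal : 'cV[R]_3 :=
  pt (cos (a 1)) (sin (a 1)) ((1 - cos (a 1)) / (2 * z')).

Definition lateral_face : set 'cV[R]_3 :=
  P `&` [set x | dot lateral_normal x = (1 + cos (a 1)) / 2].

Let h_lateral : (1 - cos (a 1)) / (2 * z') * z' = (1 - cos (a 1)) / 2.
Proof. by field; rewrite gt_eqF. Qed.

Lemma lateral_normal_ring k :
  dot lateral_normal (v k)
  = cos (a k - a 1) + (-1) ^+ k * ((1 - cos (a 1)) / 2).
Proof. by rewrite dot_pt cosB -h_lateral; ring. Qed.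

Lemma cos_angle1 : 0 < cos (a 1) < 1.
Proof.
have a1 := angle_gt0 R n_gt0 (isT : (0 < 1)%N).
have a3 : a 3 <= pi by rewrite -(angle_n R n_gt0) ler_angle.
have a3E : a 3 = a 1 + a 1 + a 1 by rewrite -!angleD.
have pi0 := pi_gt0 R.
apply/andP; split; last by apply: cos_lt1; rewrite ?mulr2n; lra.
by apply: cos_gt0_pihalf; apply/andP; split; lra.
Qed.

Lemma lateral_face_ring j : (j < 3)%N -> lateral_face (v j).
Proof.
move=> lt3; split; first by apply: trapezohedron_ring; lia.
rewrite /= lateral_normal_ring; case: j lt3 => [|[|[|j]]] // _.
- by rewrite /angle mul0r sub0r cosN; lra.
- by rewrite subrr cos0 expr1; lra.
- by rewrite (angleD R n 1 1) addrK sqrrN expr1n; lra.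
Qed.

(** Among the vertices of the ring of 0 and 2, these two are the closest in
    direction to the normal, at the angle [pi / n]; the poles are below the
    plane because they are not higher than the rings. *)
Lemma lateral_face_is_face : z <= z' ->
  is_face P lateral_face /\
  face_by lateral_normal ((1 + cos (a 1)) / 2) lateral_face.
Proof.
move=> zz'; have /andP[co0 co1] := cos_angle1.
have n0 : lateral_normal != 0.
  apply/eqP => /colP/(_ 0); rewrite !mxE /=; lra.
have sup : P `<=` [set x | dot lateral_normal x <= (1 + cos (a 1)) / 2].
  have h0 : 0 <= (1 - cos (a 1)) / (2 * z').
    by apply: divr_ge0; [lra | rewrite mulr_ge0 // ltW].
  have hz := ler_wpM2l h0 zz'; rewrite h_lateral in hz.
  have hz0 := mulr_ge0 h0 (ltW z_gt0).
  apply: trapezohedron_halfspace => [||k ltk]; [lra|lra|].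
  rewrite lateral_normal_ring -signr_odd.
  case: (boolP (odd k)) => ok; rewrite ?expr1 ?expr0.
    by have := cos_le1 (a k - a 1); lra.
  suff : cos (a k - a 1) <= cos (a 1) by lra.
  case: k ltk ok => [|[|k]] // ltk _.
    by rewrite /angle mul0r sub0r cosN.
  have -> : a k.+2 - a 1 = a k.+1 by rewrite -addn1 angleD addrK.
  apply: cos_le_of_between; rewrite ?ler_angle //.
    by rewrite ltW // angle_gt0.
  by rewrite -(angle_2n R n_gt0) lerBrDr -angleD ler_angle //; lia.
have a0 : a 0 = 0 by rewrite /angle mul0r.
have a2 : a 2 = a 1 + a 1 by rewrite -angleD.
split; last by split.
split; first by exists lateral_normal, ((1 + cos (a 1)) / 2).
exists (v 0), (v 1), (v 2); split; [exact: lateral_face_ring..|].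
apply/eqP; rewrite -mxrank_tr -[_ == _]/(row_free _); apply: inj_row_free => x.
rewrite tr_row_mx -[x]hsubmxK mul_row_col.
rewrite [lsubmx x]mx11_scalar [rsubmx x]mx11_scalar.
rewrite !mul_scalar_mx; set x1 := lsubmx x 0 0; set x2 := rsubmx x 0 0.
move=> /rowP E; have := E 1; have := E 2%:R.
rewrite !mxE /= a0 a2 sin0 expr0 expr1 sqrrN expr1n => E2 E1.
have x1_0 : x1 = 0.
  have /eqP : x1 * z' = 0 by lra.
  by rewrite mulf_eq0 (gt_eqF z'_gt0) orbF => /eqP.
have s2 : 0 < sin (a 2).
  apply: sin_gt0_pi; rewrite angle_gt0 // -(angle_n R n_gt0) ltr_angle //.
have x2_0 : x2 = 0.
  move: E1; rewrite x1_0 -a2 !subr0 mul0r add0r => /eqP.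
  by rewrite mulf_eq0 (gt_eqF s2) orbF => /eqP.
by rewrite x1_0 x2_0 !raddf0 row_mx0.
Qed.

(** When the rings are not lower than the poles, all the faces are images of the
    lateral face, which has vertices at two different heights. *)
Lemma face_tilted F c b : faces P #= `I_(2 * n) ->
  (forall k G, is_face P G -> is_face P (mx_image (r ^+ k) G)) ->
  is_face P F -> face_by c b F -> tilted c.
Proof.
move=> cardP stable faceF Fcb.
have [zz|zz] := ltP z' z; first exact: face_tilted_low_ring faceF Fcb.
have [faceL Lcb] := lateral_face_is_face zz.
have Lt : tilted lateral_normal.
  by left; rewrite mxE /= gt_eqF //; case/andP: cos_angle1.
have [_ onto] := tilted_face_orbit cardP stable faceL Lcb Lt.
have [k FE] := onto _ faceF.
apply: contrapT => /not_tilted cE.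
have height j : (j < 3)%N -> c 2%:R 0 * ((-1) ^+ k * ((-1) ^+ j * z')) = b.
  move=> lt3; have : F (r ^+ k *m v j).
    by rewrite FE; exists (v j) => //; apply: lateral_face_ring.
  by case: Fcb => _ {1}-> [_ /=]; rewrite cE rotoX_pt dot_pt !mul0r !add0r mxE.
have := height 0%N isT; have := height 1%N isT; rewrite expr0 expr1.
by have := supporting_gt0 Fcb.1; lra.
Qed.

End Trapezohedron.

(** A reflection in a line fixes only the points of the line, and a face is not
    contained in a line. *)
Lemma face_reflection_neq1 (R : realType) (z : R) (P F : set 'cV[R]_3) f :
  is_face P F -> is_face_reflection z F f -> f <> 1.
Proof.
move=> [_ [p [q [s [Fp Fq Fs rk]]]]] [_ [p0 [u [_ _ _ _ fE]]]] f1.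
have onaxis x : F x -> exists l, x - p0 = l *: u.
  move=> Fx; have := fE _ Fx; rewrite f1 mul1mx /line_reflection.
  set l := _ / _ => xE; exists (l / 2).
  have : 2%:R *: (x - p0) = l *: u.
    by apply/colP => i; move/colP/(_ i): xE; rewrite !mxE; lra.
  move=> E; rewrite mulrC -scalerA -E scalerA mulVf ?scale1r //.
have diff x y : F x -> F y -> exists l, x - y = l *: u.
  move=> /onaxis[l lE] /onaxis[l' l'E]; exists (l - l').
  by rewrite scalerBl -lE -l'E opprB addrA subrK.
have [l qp] := diff _ _ Fq Fp; have [l' sp] := diff _ _ Fs Fp.
by move: rk; rewrite qp sp => rk; have := rank_row_mx_scale u l l'; rewrite rk.
Qed.

(** * Tilings as words *)

Section Coordinates.
Variables (R : realType) (P : set 'cV[R]_3) (A : set 'M[R]_3) (T : finType).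
Variable rho : 'M[R]_3 -> T * faces P -> T * faces P.
Variables (p : nat) (r f : 'M[R]_3) (F : faces P).
Hypotheses (closedA : mx_group_closed A) (rhoA : is_design_action A rho).
Hypotheses (Ar : A r) (Af : A f).
Hypotheses (rm : r ^+ p.+2 = 1) (ff : f * f = 1) (rfr : r * f * r = f).
Hypothesis A_elements : forall g, A g ->
  exists (k : nat) (b : bool), g = r ^+ k * f ^+ b.
Hypothesis fF : mx_image f (val F) = val F.
Hypothesis r_inj : injective (fun k : 'I_p.+2 => mx_image (r ^+ k) (val F)).
Hypothesis r_onto : forall G : faces P,
  exists k : 'I_p.+2, val G = mx_image (r ^+ k) (val F).

Definition flip (D : T) : T := (rho f (D, F)).1.

Let rhoM g h x : A g -> A h -> rho (g * h) x = rho g (rho h x).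
Proof. by case: rhoA => _ rM _ Ag Ah; apply: rM. Qed.
Let rho1 x : rho 1 x = x. Proof. by case: rhoA. Qed.
Let rho2 g x : A g -> val (rho g x).2 = mx_image g (val x.2).
Proof. by case: rhoA => _ _ rI Ag; apply: rI. Qed.

Lemma flipE D : rho f (D, F) = (flip D, F).
Proof.
by rewrite [LHS]surjective_pairing; congr pair; apply: val_inj; rewrite rho2.
Qed.

Lemma flipK : involutive flip.
Proof.
by move=> D; rewrite {1}/flip -flipE -rhoM // ff rho1.
Qed.

Lemma card_flip_fix : fixed_designs rho f F = #|[set D | flip D == D]%SET|.
Proof.
rewrite /fixed_designs; apply: eq_card => D; rewrite !inE flipE.
by apply/asboolP/eqP => [[]|->].
Qed.

Let Arj k : A (r ^+ k). Proof. exact: closedX. Qed.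
Let Afb (b : bool) : A (f ^+ b). Proof. exact: closedX. Qed.
Let AM g h : A g -> A h -> A (g * h).
Proof. by case: closedA => _ + _; apply. Qed.

(** The trivialization of the bundle of designs: [frame] identifies T x Z/(p+2)
    with the pairs (design, face). *)
Definition frame (j : 'I_p.+2) (D : T) : T * faces P := rho (r ^+ j) (D, F).

Lemma expr_add (i j : 'I_p.+2) : r ^+ (i + j)%R = r ^+ i * r ^+ j.
Proof. by rewrite /= expr_mod // exprD. Qed.

Lemma expr_opp (j : 'I_p.+2) : r ^+ (- j)%R * r ^+ j = 1.
Proof. by rewrite -expr_add addNr. Qed.

Lemma expr_affine (g : dihedral p) (j : 'I_p.+2) :
  r ^+ g.1 * f ^+ g.2 * r ^+ j = r ^+ (dih_affine g j) * f ^+ g.2.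
Proof.
rewrite /dih_affine expr_add -!mulrA; congr (_ * _); case: g.2.
  by rewrite !expr1 mulN1r -[in RHS](reversed_expr j rfr) !mulrA expr_opp mul1r.
by rewrite !expr0 mul1r mulr1 mul1r.
Qed.

(** In the coordinates given by [frame], the group acts on the index by affine
    maps and on the design only by [flip]. *)
Lemma rho_frame (g : dihedral p) j D :
  rho (r ^+ g.1 * f ^+ g.2) (frame j D)
  = frame (dih_affine g j) (iter g.2 flip D).
Proof.
rewrite /frame -rhoM //; last exact: AM.
rewrite expr_affine rhoM //; congr rho.
by case: g.2; rewrite ?expr0 ?rho1 ?expr1 ?flipE.
Qed.

Lemma frame_face j D : val (frame j D).2 = mx_image (r ^+ j) (val F).
Proof. exact: rho2. Qed.

Lemma frame_inj i j D E : frame i D = frame j E -> i = j /\ D = E.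
Proof.
move=> ij; have ijE : i = j.
  by apply: r_inj; rewrite -(frame_face i D) ij frame_face.
split=> //; move: ij; rewrite ijE /frame => /(congr1 (rho (r ^+ (- j)%R))).
by rewrite -!rhoM // expr_opp !rho1 => -[].
Qed.

Lemma frame_onto X G : exists j D, frame j D = (X, G).
Proof.
have [j GE] := r_onto G.
exists j, (rho (r ^+ (- j)%R) (X, G)).1.
have rV : r ^+ j * r ^+ (- j)%R = 1 by rewrite -expr_add addrN.
have : rho (r ^+ (- j)%R) (X, G) = ((rho (r ^+ (- j)%R) (X, G)).1, F).
  rewrite [LHS]surjective_pairing; congr pair; apply: val_inj.
  by rewrite rho2 //= GE -mx_imageM expr_opp mx_image1.
by rewrite /frame => <-; rewrite -rhoM // rV rho1.
Qed.

Variable D0 : T.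
Let face j : faces P := (frame j D0).2.

Lemma frame2 j D : (frame j D).2 = face j.
Proof. by apply: val_inj; rewrite !frame_face. Qed.

Lemma frame_design_onto j (X : T) : exists D, (frame j D).1 = X.
Proof.
have [i [D E]] := frame_onto X (face j); exists D.
have -> : j = i by apply: r_inj; rewrite -(frame_face j D0) -(frame_face i D) E.
by rewrite E.
Qed.

Lemma word_exists (tau : faces P -> T) :
  exists w : {ffun 'I_p.+2 -> T}, forall j, (frame j (w j)).1 = tau (face j).
Proof.
have /choice[w wE] j := frame_design_onto j (tau (face j)).
by exists (finfun w) => j; rewrite ffunE.
Qed.

(** The [j]-th letter of the word of a tiling is the design over [F] that is
    carried by [r ^+ j] to the design of the [j]-th face. *)
Definition word (tau : faces P -> T) := projT1 (cid (word_exists tau)).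

Lemma wordE tau j : frame j (word tau j) = (tau (face j), face j).
Proof.
rewrite [LHS]surjective_pairing frame2.
by congr pair; apply: (projT2 (cid (word_exists tau))).
Qed.

Lemma face_onto G : exists j, face j = G.
Proof.
by have [j [D E]] := frame_onto D0 G; exists j; rewrite -(frame2 j D) E.
Qed.

Lemma word_onto w : exists tau, word tau = w.
Proof.
have /choice[idx idxE] := face_onto.
exists (fun G => (frame (idx G) (w (idx G))).1); apply/ffunP => j.
set tau := (X in word X).
have : frame j (word tau j) = frame j (w j).
  have -> : frame j (w j) = frame (idx (face j)) (w (idx (face j))).
    suff -> : idx (face j) = j by [].
    by apply: r_inj; rewrite -!(frame_face _ D0) -/(face _) idxE.
  by rewrite wordE [RHS]surjective_pairing frame2 idxE.
by case/frame_inj.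
Qed.

Lemma mem_tiling_graph tau j D :
  tiling_graph tau (frame j D) <-> D = word tau j.
Proof.
split=> [[G _ E]|->]; last by exists (face j); rewrite ?wordE.
have GE : face j = G by rewrite -(frame2 j D) -E.
by move: E; rewrite -GE -wordE => /frame_inj[].
Qed.

(** A matrix that carries [tau] to [sigma] corresponds to a group element that
    carries the word of [sigma] to the word of [tau], since words are acted
    upon by precomposition; orbits do not see the difference. *)
Lemma tiling_orbitE tau sigma : tiling_orbit A rho tau sigma <->
  word sigma \in orbit (turn_action p flipK) [set: dihedral p]%SET (word tau).
Proof.
have graphE (g : dihedral p) :
    rho (r ^+ g.1 * f ^+ g.2) @` tiling_graph tau = tiling_graph sigma <->
    turn flip (word sigma) g = word tau.
  split=> [gE|gE].
    apply/ffunP => j; rewrite ffunE.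
    have : tiling_graph sigma
        (frame (dih_affine g j) (iter g.2 flip (word tau j))).
      rewrite -gE -rho_frame; exists (frame j (word tau j)) => //.
      exact/mem_tiling_graph.
    move/mem_tiling_graph <-.
    by case: g.2 => //=; rewrite flipK.
  have word_tau j : word sigma (dih_affine g j) = iter g.2 flip (word tau j).
    by rewrite -gE ffunE; case: g.2 => //=; rewrite flipK.
  apply/seteqP; split=> [_ [[X G] + <-]|[X G]].
    have [j [D <-]] := frame_onto X G.
    by move/mem_tiling_graph => ->; rewrite rho_frame; apply/mem_tiling_graph.
  have [i [D <-]] := frame_onto X G => /mem_tiling_graph ->.
  pose j := dih_affine (dih_inv g) i.
  have <- : dih_affine g j = i.
    rewrite -dih_affineM -[dih_mul _ _]/((g : dihedral p) * g^-1)%g mulgV.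
    by rewrite /dih_affine /= mul1r add0r.
  exists (frame j (word tau j)); first exact/mem_tiling_graph.
  by rewrite rho_frame word_tau.
rewrite orbit_sym; split.
  move=> [g /A_elements[k [b ->]]].
  have -> : r ^+ k = r ^+ (inZp k : 'I_p.+2) by rewrite /= expr_mod.
  move=> /(graphE (inZp k, b)) <-.
  by apply/orbitP; exists ((inZp k, b) : dihedral p); rewrite ?inE.
move=> /orbitP[g _ /= /graphE gE].
by exists (r ^+ g.1 * f ^+ g.2) => //; apply: AM.
Qed.

Lemma card_tiling_orbits : tiling_orbits A rho #=
  `I_#|orbit (turn_action p flipK) [set: dihedral p]
       @: [set: {ffun 'I_p.+2 -> T}]|%SET.
Proof.
set O := (_ @: _)%SET.
(* The orbits of tilings are the preimages of the orbits of words. *)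
pose h (i : 'I_#|O|) : set (faces P -> T) :=
  [set sigma | word sigma \in enum_val i].
have h_inj : injective h.
  move=> i j ij; apply/enum_val_inj/setP => w; have [tau <-] := word_onto w.
  by apply/idP/idP; [change (h i tau -> h j tau) | change (h j tau -> h i tau)];
    rewrite ij.
have orbE tau i :
    enum_val i = orbit (turn_action p flipK) [set: dihedral p]%SET (word tau) ->
    tiling_orbit A rho tau = h i.
  move=> iE; apply/seteqP; split=> sigma.
    by move/tiling_orbitE; rewrite /h /= iE.
  by rewrite /h /= iE => /tiling_orbitE.
have -> : tiling_orbits A rho = range h.
  apply/seteqP; split=> [_ [tau _ <-]|_ [i _ <-]].
    set o := orbit (turn_action p flipK) [set: dihedral p]%SET (word tau).
    have oO : o \in O by apply: imset_f.
    exists (enum_rank_in oO o) => //; apply/esym/orbE.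
    by rewrite enum_rankK_in.
  have /imsetP[w _ wE] := enum_valP i; have [tau tauE] := word_onto w.
  by exists tau => //; apply: orbE; rewrite tauE.
apply: (card_eq_trans (B := [set: 'I_#|O|])); last first.
  by rewrite card_eq_sym card_II.
by apply: inj_card_eq => i j _ _; apply: h_inj.
Qed.

End Coordinates.

(** * Counting the tilings *)

Theorem theorem19 (R : realType) (n : nat) (n_ge3 : (3 <= n)%N)
    (z z' : R) (z_gt0 : 0 < z) (z'_gt0 : 0 < z')
    (kites : faces_are_kites n z z')
    (T : finType)
    (rho : 'M[R]_3 -> T * faces (trapezohedron n z z') ->
           T * faces (trapezohedron n z z'))
    (rho_action : is_design_action (Dnd R n) rho)
    (F : faces (trapezohedron n z z')) (f : 'M[R]_3) (f_in : Dnd R n f)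
    (f_refl : is_face_reflection z (val F) f)
    (t_id t_f : nat) (t_idE : #|T| = t_id)
    (t_fE : fixed_designs rho f F = t_f) :
  exists N : nat,
    tiling_orbits (Dnd R n) rho #= `I_N /\
    N%:R = 1 / 4 * (t_id%:R ^+ n + t_id%:R ^+ (n - 1) * t_f%:R ^+ 2)
           + 1 / (4 * n%:R) *
             \sum_(d <- divisors (2 * n))
               (totient d)%:R * t_id%:R ^+ (2 * n %/ d) :> rat.
Proof.
have n0 : (0 < n)%N by exact: leq_trans n_ge3.
(* Without designs there is no tiling, and all the powers vanish. *)
have [T0 | /card_gt0P[D0 _]] := posnP #|T|.
  exists 0%N; split.
    have -> : tiling_orbits (Dnd R n) rho = set0; last by rewrite II0.
    rewrite -subset0 => X [tau _ _].
    by have := fintype0 (tau F) T0.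
  rewrite -t_idE T0 !expr0n; have -> : (n - 1 == 0)%N = false by lia.
  rewrite gtn_eqF //= mul0r addr0 mulr0 add0r big_seq big1 ?mulr0 // => d.
  rewrite -dvdn_divisors ?muln_gt0 // => d2n; rewrite expr0n.
  have d0 : (0 < d)%N by apply: dvdn_gt0 d2n; rewrite muln_gt0.
  by rewrite gtn_eqF ?mulr0 // divn_gt0 // dvdn_leq // muln_gt0.
(* Residues modulo 2n are used in the form [p.+2], for which they are a ring. *)
have [p pE] : exists p, p.+2 = (2 * n)%N by exists (2 * n - 2)%N; lia.
set P := trapezohedron n z z'; set r := rotoreflection R n.
have faceF : is_face P (val F) := set_mem (valP F).
(* An action on the pairs (design, face) shows in particular that the group
   permutes the faces. *)
have stable k G : is_face P G -> is_face P (mx_image (r ^+ k) G).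
  move=> faceG; pose G' : faces P := SigSub (mem_set (faceG : faces P G)).
  have rk := closedX k (@Dnd_closed R n) (@Dnd_roto R n).
  case: rho_action => _ _ /(_ _ rk (D0, G')) /= <-.
  exact: set_mem (valP _).
have [c [b Fcb]] := faceP faceF.
have cardP := kites.1.
have ct := face_tilted n_ge3 z_gt0 z'_gt0 cardP stable faceF Fcb.
have [r_inj r_onto] :=
  tilted_face_orbit n_ge3 z_gt0 z'_gt0 cardP stable faceF Fcb ct.
rewrite -pE in r_inj r_onto.
have rm : r ^+ p.+2 = 1 by rewrite pE rotoX_period.
have [a [s [lta fE]]] := Dnd_elements n0 f_in.
have fF : mx_image f (val F) = val F := f_refl.1.
have sE : s = true.
  case: s fE => // fE; rewrite expr0 mulr1 in fE.
  case: (face_reflection_neq1 faceF f_refl).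
  rewrite fE (face_rotoX_free n_ge3 z_gt0 z'_gt0 faceF Fcb ct lta) //.
  by rewrite -[X in mx_image X]fE.
rewrite sE expr1 -/r in fE.
have ff : f * f = 1.
  by rewrite {2}fE mulrA fE roto_expr_mirror mirror_sqr.
have rfr : r * f * r = f.
  rewrite fE (mulrA r) -exprS exprSr -!mulrA (mulrA r) roto_mirror //.
have A_elements g : Dnd R n g -> exists k (b : bool), g = r ^+ k * f ^+ b.
  move=> /(Dnd_elements n0)[k [[] [_ ->]]]; last first.
    by exists k, false.
  exists (k + (2 * n - a))%N, true.
  rewrite exprD -mulrA expr1 fE (mulrA (r ^+ (_ - _))).
  by rewrite -exprD subnK ?rotoX_period ?mul1r // ltnW.
have onto (G : faces P) : exists k : 'I_p.+2, val G = mx_image (r ^+ k) (val F).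
  by apply: r_onto; apply: set_mem (valP G).
have := card_tiling_orbits (@Dnd_closed R n) rho_action (@Dnd_roto R n) f_in
  rm ff rfr A_elements fF r_inj onto D0.
set K := flipK _ _ _ _; set N := #|_| => cardN.
exists N; split=> //.
have := card_word_orbits K D0 pE; rewrite -/N.
rewrite -(card_flip_fix rho_action f_in fF) t_fE t_idE.
move=> /(congr1 (fun k => k%:R : rat)).
rewrite !(natrM, natrD, natrX) natr_sum => NE.
under eq_bigr => d _ do rewrite -natrX -natrM.
have n0' : n%:R != 0 :> rat by rewrite pnatr_eq0 -lt0n.
have n4 : 4 * n%:R != 0 :> rat by rewrite mulf_neq0.
by apply: (mulIf n4); rewrite NE; field.
Qed.
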